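(* For any positive integer $d$, there exist a positive integer $n$ which is not a square, a fundamental solution $(a,b)$ of the Pell equation $x^2-ny^2=1$, and a parametric solution $P,Q,D\in\mathbb{Z}[X]$ of degree $d$ associated to $(a,b)$.
   Context: For a positive non-square integer $n$, let $V$ be the group of elements of norm $1$ in $\mathbb{Z}[\sqrt n]$, i.e. the elements $x+y\sqrt n$ with $x,y\in\mathbb{Z}$ and $x^2-ny^2=1$. A solution $(a,b)\in\mathbb{Z}^2$ of $x^2-ny^2=1$ is fundamental if $V$ is generated by $-1$ and $a+b\sqrt n$. A parametric solution associated to a solution $(a,b)$ is a triple of polynomials $P,Q,D$ with $\deg(D)=2$, $P^2-DQ^2=1$, $P(0)=a$, $Q(0)=b$ and $D(0)=n$. Its degree is $\deg(P)$. *)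

(* Defs.v *)
From mathcomp Require Import all_boot all_order all_algebra all_field.

Set Implicit Arguments.
Unset Strict Implicit.
Unset Printing Implicit Defensive.

Import Order.TTheory GRing.Theory Num.Theory.
Local Open Scope ring_scope.

(* The ring Z[sqrt n] is realized inside algC; sqrtC n%:R is the nonnegative
   real square root of n. *)
Definition quad (n : nat) (x y : int) : algC :=
  x%:~R + y%:~R * sqrtC (n%:R).

Definition pell_solution (n : nat) (x y : int) : Prop :=
  x ^+ 2 - n%:Z * y ^+ 2 = 1.

(* x ^+ 2 - n * y ^+ 2 is the norm of x + y * sqrt n; when n is not a square,
   x and y are determined by the element z. *)
Definition norm1_group (n : nat) (z : algC) : Prop :=
  exists x y : int, z = quad n x y /\ pell_solution n x y.

(* The subgroup generated by S in the group of units of R, provided that every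
   element of S is a unit. *)
Inductive generated_subgroup (R : unitRingType) (S : R -> Prop) : R -> Prop :=
| generated_mem z : S z -> generated_subgroup S z
| generated_one : generated_subgroup S 1
| generated_mul z w : generated_subgroup S z -> generated_subgroup S w ->
    generated_subgroup S (z * w)
| generated_inv z : generated_subgroup S z -> generated_subgroup S z^-1.

Definition fundamental_solution (n : nat) (a b : int) : Prop :=
  pell_solution n a b /\
  forall z : algC, norm1_group n z <->
    generated_subgroup (fun w => w = -1 \/ w = quad n a b) z.

(* size D = 3 means that D has degree 2. *)
Definition parametric_solution (n : nat) (a b : int) (P Q D : {poly int}) :
    Prop :=
  [/\ size D = 3%N, P ^+ 2 - D * Q ^+ 2 = 1,
      P.[0] = a, Q.[0] = b & D.[0] = n%:Z].

(* Main.v *)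
Require Import Defs.
From mathcomp Require Import all_boot all_order all_algebra all_field.
From mathcomp Require Import ring zify.

(** If a > 1, then (a, 1) is a fundamental solution of the Pell equation for
    n = a ^ 2 - 1: no solution has a smaller positive second coordinate
    ([fundamental_solution_sqr_sub1]). So it is enough to find a parametric
    solution of degree d that passes through such a pair.

    The Chebyshev polynomials, written T and U here, satisfy
    T ^ 2 - ('X^2 - 1) * U ^ 2 = 1 with deg T = d ([chebyshev_pell],
    [size_chebyshevT]). At 2 this reads a ^ 2 - 3 * u ^ 2 = 1 with a = T(2) and
    u = U(2). Moving the factor u ^ 2 into the coefficient of the equation
    turns the d-th power of the unit 2 + sqrt 3 into the solution (a, 1) for
    n = 3 * u ^ 2 = a ^ 2 - 1, which is fundamental although the initial unit
    is not in Z[sqrt n]. To do this along a whole family, substitute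
    2 + u * X for X: as U(2 + u * X) = U(2) = 0 modulo u, there is an integer
    polynomial Q with U(2 + u * X) = u * Q and Q(0) = 1
    ([comp_poly_affine_factor]), and
    P = T(2 + u * X), D = u ^ 2 * ((2 + u * X) ^ 2 - 1) complete the triple. *)

Set Implicit Arguments.
Unset Strict Implicit.
Unset Printing Implicit Defensive.

Import Order.TTheory GRing.Theory Num.Theory.
Local Open Scope ring_scope.

Lemma mul_quad n (x y x' y' : int) :
  quad n x y * quad n x' y' = quad n (x * x' + n%:Z * (y * y')) (x * y' + y * x').
Proof.
rewrite /quad !rmorphD !rmorphM /=.
have := sqrtCK (n%:R : algC); move: (sqrtC _) => r r2.
by rewrite -pmulrn -r2; ring.
Qed.

Lemma quad10 n : quad n 1 0 = 1.
Proof. by rewrite /quad mul0r addr0. Qed.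

Lemma opp_quad n (x y : int) : - quad n x y = quad n (- x) (- y).
Proof. by rewrite /quad !rmorphN /=; ring. Qed.

Lemma inv_quad n (x y : int) :
  pell_solution n x y -> (quad n x y)^-1 = quad n x (- y).
Proof.
rewrite /pell_solution => hxy.
suff h : quad n x y * quad n x (- y) = 1.
  have nz : quad n x y != 0.
    by apply: contra_eq_neq h => ->; rewrite mul0r eq_sym oner_neq0.
  by rewrite -[LHS]mulr1 -h mulKf.
rewrite mul_quad -[RHS](quad10 n).
by congr quad; [rewrite -hxy|]; ring.
Qed.

Lemma generated_opp (S : algC -> Prop) z :
  S (-1) -> generated_subgroup S z -> generated_subgroup S (- z).
Proof.
by move=> hS hz; rewrite -mulN1r; apply: generated_mul => //; apply: generated_mem.
Qed.

Lemma generated_norm1 n (a b : int) z : pell_solution n a b ->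
  generated_subgroup (fun w => w = -1 \/ w = quad n a b) z -> norm1_group n z.
Proof.
move=> hab; elim=> {z} [z [->|->]||z w _ [x [y [-> hz]]] _ [x' [y' [-> hw]]]
  |z _ [x [y [-> hz]]]].
- exists (-1), 0; rewrite /pell_solution; split; last by ring.
  by rewrite -(quad10 n) opp_quad oppr0.
- by exists a, b.
- by exists 1, 0; rewrite quad10; split=> //; rewrite /pell_solution; ring.
- rewrite mul_quad; do 2!eexists; split; first by [].
  rewrite /pell_solution in hz hw *.
  by rewrite -[RHS](mulr1 1) -{1}hz -{1}hw; ring.
- exists x, (- y); rewrite inv_quad //; split=> //.
  by rewrite /pell_solution sqrrN.
Qed.

(** Descent on y: dividing a solution with y > 0 by a + sqrt n gives another
    one with a nonnegative second coordinate that is smaller than y. *)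
Lemma nonneg_solution_generated n (a : int) (m : nat) : 1 < a ->
  n%:Z = a ^+ 2 - 1 -> forall x y : int, 0 < x -> 0 <= y -> y <= m%:Z ->
  pell_solution n x y ->
  generated_subgroup (fun w => w = -1 \/ w = quad n a 1) (quad n x y).
Proof.
move=> ha hn; elim: m => [|m IH] x y hx hy hym hp.
  have y0 : y = 0 by lia.
  rewrite /pell_solution y0 in hp *.
  have -> : x = 1 by nia.
  by rewrite quad10; apply: generated_one.
have [y0|y_gt0] : y = 0 \/ 0 < y by lia.
  by apply: IH => //; lia.
rewrite /pell_solution hn in hp.
have -> : quad n x y =
    quad n (a * x - n%:Z * y) (a * y - x) * quad n a 1.
  by rewrite mul_quad hn; congr quad; ring.
apply: generated_mul; last by apply: generated_mem; right.
(* The bounds (a - 1) * y < x <= a * y say that the new second coordinate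
   a * y - x is in [0, y[. They follow by comparing squares, as
   x ^ 2 = 1 + (a ^ 2 - 1) * y ^ 2. *)
have le_x : x <= a * y.
  rewrite leNgt; apply/negP => lt_x.
  have : (a * y + 1) ^+ 2 <= x ^+ 2 by rewrite lerXn2r ?nnegrE //; nia.
  nia.
have gt_x : (a - 1) * y < x.
  rewrite ltNge; apply/negP => x_le.
  have : x ^+ 2 <= ((a - 1) * y) ^+ 2 by rewrite lerXn2r ?nnegrE //; nia.
  nia.
apply: IH; [|nia|nia|by rewrite /pell_solution hn -[RHS]hp; ring].
rewrite hn; rewrite ltNge; apply/negP => le_ax.
have : (a * x) ^+ 2 <= ((a ^+ 2 - 1) * y) ^+ 2.
  by rewrite lerXn2r ?nnegrE //; nia.
have -> : (a * x) ^+ 2 = a ^+ 2 * (1 + (a ^+ 2 - 1) * y ^+ 2).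
  by rewrite -{1}hp; ring.
nia.
Qed.

(** The signs of the coordinates are adjusted by inversion, which changes the
    sign of y, and by -1, which changes both. *)
Lemma fundamental_solution_sqr_sub1 n (a : int) : 1 < a ->
  n%:Z = a ^+ 2 - 1 -> fundamental_solution n a 1.
Proof.
move=> ha hn.
have ha1 : pell_solution n a 1 by rewrite /pell_solution hn; ring.
split=> // z; split; last exact: generated_norm1.
case=> x [y [-> hp]].
have step x' y' : 0 < x' -> pell_solution n x' y' ->
    generated_subgroup (fun w => w = -1 \/ w = quad n a 1) (quad n x' y').
  move=> hx' hp'; have [hy|hy] := leP 0 y'.
    by apply: (@nonneg_solution_generated n a `|y'|%N) => //; lia.
  have hp2 : pell_solution n x' (- y') by rewrite /pell_solution sqrrN.
  rewrite -[y']opprK -inv_quad //; apply: generated_inv.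
  by apply: (@nonneg_solution_generated n a `|y'|%N) => //; lia.
have [hx|hx] := ltP 0 x; first exact: step.
rewrite -[quad n x y]opprK; apply: generated_opp; first by left.
rewrite opp_quad; apply: step; last by rewrite /pell_solution !sqrrN.
by rewrite /pell_solution hn in hp; nia.
Qed.

Lemma sqr_sub1_not_square n (a : int) : 1 < a -> n%:Z = a ^+ 2 - 1 ->
  ~ exists m : nat, n = (m ^ 2)%N.
Proof.
move=> ha hn [m hm].
have {}hn : m%:Z * m%:Z = a * a - 1 by move: hn; rewrite hm; lia.
have [h|h] := ltP m%:Z a; nia.
Qed.

(** The coordinates of ('X + sqrt ('X^2 - 1)) ^ k in the basis
    1, sqrt ('X^2 - 1). The first is the k-th Chebyshev polynomial of the first
    kind, the second the (k - 1)-th of the second kind. *)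
Definition chebyshev (k : nat) : {poly int} * {poly int} :=
  iter k (fun tu => ('X * tu.1 + ('X^2 - 1) * tu.2, tu.1 + 'X * tu.2)) (1, 0).

Definition chebyshevT k := (chebyshev k).1.
Definition chebyshevU k := (chebyshev k).2.

Lemma chebyshevTS k :
  chebyshevT k.+1 = 'X * chebyshevT k + ('X^2 - 1) * chebyshevU k.
Proof. by []. Qed.

Lemma chebyshevUS k : chebyshevU k.+1 = chebyshevT k + 'X * chebyshevU k.
Proof. by []. Qed.

Lemma chebyshev_pell k :
  chebyshevT k ^+ 2 - ('X^2 - 1) * chebyshevU k ^+ 2 = 1.
Proof.
elim: k => [|k IH]; first by rewrite /chebyshevT /chebyshevU /=; ring.
by rewrite chebyshevTS chebyshevUS -[RHS]IH; ring.
Qed.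

(** As 'X * U(k+1) = 'X * (T(k) + 'X * U(k)) and T(k+1) is the same minus U(k),
    the coefficients of T(k) and 'X * U(k) at 'X^k can be followed together;
    the one of T(k) stays positive, because U(k), of smaller degree, contributes
    nothing at 'X^(k+1). *)
Lemma size_chebyshevT k : size (chebyshevT k) = k.+1.
Proof.
suff [szT szU T_gt0 _] : [/\ (size (chebyshevT k) <= k.+1)%N,
    (size ('X * chebyshevU k)%R <= k.+1)%N,
    0 < (chebyshevT k)`_k & 0 <= ('X * chebyshevU k)`_k].
  apply/eqP; rewrite eqn_leq szT /= ltnNge; apply/negP => szT'.
  by rewrite nth_default // ltxx in T_gt0.
elim: k => [|k [szT szU T_gt0 U_ge0]].
  rewrite /chebyshevT /chebyshevU /=.
  by rewrite mulr0 size_poly1 size_poly0 coef1 coef0.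
have eqT : chebyshevT k.+1
    = 'X * (chebyshevT k + 'X * chebyshevU k) - chebyshevU k.
  by rewrite chebyshevTS; ring.
rewrite eqT chebyshevUS.
have U0 j : (k <= j)%N -> (chebyshevU k)`_j = 0.
  move=> hj; have -> : (chebyshevU k)`_j = ('X * chebyshevU k)`_j.+1.
    by rewrite coefXM.
  by apply: nth_default; apply: leq_trans szU _.
split.
- apply/leq_sizeP => -[|j] hj //.
  rewrite coefB coefXM coefD /= (U0 j.+1) ?subr0; last by lia.
  by rewrite !nth_default ?addr0 //; [apply: leq_trans szU _|apply: leq_trans szT _].
- apply/leq_sizeP => -[|j] hj //.
  rewrite coefXM coefD /=.
  by rewrite !nth_default ?addr0 //; [apply: leq_trans szU _|apply: leq_trans szT _].
- by rewrite coefB coefXM coefD /= (U0 k.+1) // subr0 ltr_wpDr.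
- by rewrite coefXM coefD /= addr_ge0 // ltW.
Qed.

Lemma chebyshev_at2 k :
  0 < (chebyshevT k).[2] /\ 0 <= (chebyshevU k).[2].
Proof.
elim: k => [|k [hT hU]]; first by rewrite /chebyshevT /chebyshevU /= !hornerE.
rewrite chebyshevTS chebyshevUS !hornerE.
by move: _.[2] (chebyshevU k).[2] hT hU => x y; split; lia.
Qed.

(** The polynomial p(c + m * X) is p(c) modulo m * X, by the factor theorem for
    p - p(c) at c. *)
Lemma comp_poly_affine_factor (R : comNzRingType) (p : {poly R}) (c m : R) :
  p.[c] = m -> exists2 q : {poly R}, q.[0] = 1 &
    p \Po (c%:P + m%:P * 'X) = m%:P * q.
Proof.
move=> hm.
have /factor_theorem [w hw] : root (p - m%:P) c.
  by rewrite /root !hornerE hm subrr.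
exists (1 + 'X * (w \Po (c%:P + m%:P * 'X))); first by rewrite !hornerE.
have -> : p = w * ('X - c%:P) + m%:P by rewrite -hw subrK.
by rewrite comp_polyD comp_polyM comp_polyB !comp_polyC comp_polyX; ring.
Qed.

Lemma size_affine (R : idomainType) (c m : R) : m != 0 ->
  size (c%:P + m%:P * 'X) = 2%N.
Proof.
by move=> m0; rewrite addrC size_MXaddC polyC_eq0 (negPf m0) size_polyC m0.
Qed.

Theorem corollary6 (d : nat) (hd : (0 < d)%N) :
  exists n : nat,
    (0 < n)%N /\ (~ exists m : nat, n = (m ^ 2)%N) /\
    exists a b : int,
      fundamental_solution n a b /\
      exists P Q D : {poly int},
        parametric_solution n a b P Q D /\ size P = d.+1.
Proof.
set T := chebyshevT d; set U := chebyshevU d.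
set a := T.[2]; set u := U.[2].
have u_gt0 : 0 < u.
  rewrite /u /U; case: d hd {T U a u} => // k _.
  have [hT hU] := chebyshev_at2 k.
  by rewrite chebyshevUS !hornerE; move: _.[2] (chebyshevU k).[2] hT hU => x y; lia.
have a_gt0 : 0 < a by case: (chebyshev_at2 d).
have pellTU : T ^+ 2 - ('X^2 - 1) * U ^+ 2 = 1 := chebyshev_pell d.
have au : a ^+ 2 - 3 * u ^+ 2 = 1.
  have /(congr1 (horner^~ 2)) := pellTU.
  by rewrite /a /u !hornerE /= => h; rewrite -[RHS]h; ring.
have a_gt1 : 1 < a by nia.
pose n := `|(3 * u ^+ 2)%R|%N.
have nE : n%:Z = 3 * u ^+ 2 by rewrite /n; nia.
have na : n%:Z = a ^+ 2 - 1 by rewrite nE; lia.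
exists n; split; first by rewrite /n; nia.
split; first exact: sqr_sub1_not_square a_gt1 na.
exists a, 1; split; first exact: fundamental_solution_sqr_sub1.
pose l : {poly int} := 2%:P + u%:P * 'X.
have szl : size l = 2%N by rewrite size_affine // gt_eqF.
have l0 : l.[0] = 2 by rewrite /l !hornerE.
have [Q Q0 hQ] := @comp_poly_affine_factor _ U 2 u erefl.
rewrite -/l in hQ; clearbody l.
exists (T \Po l), Q, (u%:P ^+ 2 * (l ^+ 2 - 1)); split; last first.
  by rewrite size_comp_poly2 ?size_chebyshevT.
split=> //.
- rewrite -rmorphXn /= mul_polyC size_scale ?expf_neq0 ?gt_eqF //.
  have szl2 : size (l ^+ 2) = 3%N by rewrite expr2 size_mul -?size_poly_eq0 szl.
  by rewrite size_polyDl ?szl2 // size_polyN size_poly1.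
- have := congr1 (comp_poly l) pellTU.
  rewrite !(expr2, comp_polyB, comp_polyM) comp_polyX rmorph1 hQ.
  by move=> h; rewrite -[RHS]h; ring.
- by rewrite horner_comp l0.
- by rewrite !hornerE l0 nE; ring.
Qed.
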